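(* For every completely pivoted real $5\times5$ matrix $A$, $g(A)\le 4.84$. (Equivalently, the growth factor of Gaussian elimination with complete pivoting on any real $5\times 5$ matrix is at most $4.84$.)
   Context: For a real $n\times n$ matrix $A$ and $k=1,\dots,n$, set $A^{(k)} := A_{k:n,k:n} - A_{k:n,1:k-1}\,[A_{1:k-1,1:k-1}]^{-1} A_{1:k-1,k:n}$, where $A_{i:j,k:\ell}$ is the submatrix with rows $i,\dots,j$ and columns $k,\dots,\ell$; entries of $A^{(k)}$ are indexed by $i,j\in\{k,\dots,n\}$ ($A^{(k)}$ is the matrix remaining after $k-1$ steps of Gaussian elimination; relevant leading principal submatrices are assumed invertible). $A$ is completely pivoted if $|A^{(k)}_{i,j}|\le|A^{(k)}_{k,k}|$ for all $i,j=k,\dots,n$, $k=1,\dots,n-1$. For completely pivoted $A=LU$ ($L$ unit lower triangular, $U$ upper triangular) the growth factor is $g(A)=\max\{\|L\|_{\max},\|U\|_{\max}/\|A\|_{\max}\}$, where $\|\cdot\|_{\max}$ is the largest absolute value of an entry. *)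

(* Defs.v *)
From HB Require Import structures.
From mathcomp Require Import all_boot all_order all_algebra.
From mathcomp Require Import reals.
Set Implicit Arguments. Unset Strict Implicit. Unset Printing Implicit Defensive.
Import Order.TTheory GRing.Theory Num.Theory.
Local Open Scope ring_scope.

Section GrowthDefs.
Variable R : realType.

(* Leading principal k x k submatrix A_{1:k,1:k} of an (n+1) x (n+1) matrix
   (meaningful for k <= n+1). *)
Definition lead_mx (n : nat) (A : 'M[R]_n.+1) (k : nat) : 'M[R]_k :=
  \matrix_(p < k, q < k) A (inord p) (inord q).

(* Entry (i,j) of the Schur complement after k steps of Gaussian elimination
   (0-based k; this is A^{(k+1)} of the paper):
   A_{ij} - A_{i,1:k} [A_{1:k,1:k}]^{-1} A_{1:k,j}, meaningful for i, j >= k. *)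
Definition schur (n : nat) (A : 'M[R]_n.+1) (k : nat) (i j : 'I_n.+1) : R :=
  A i j - \sum_(p < k) \sum_(q < k)
            A i (inord p) * (invmx (lead_mx A k)) p q * A (inord q) j.

(* Completely pivoted, for an N x N matrix with N = n+1: for each 0-based step
   k = 0..N-2 (paper's k = 1..N-1), |A^{(k)}_{ij}| <= |A^{(k)}_{kk}|. *)
Definition completely_pivoted (n : nat) (A : 'M[R]_n.+1) : Prop :=
  forall k : nat, (k < n)%N ->
    forall i j : 'I_n.+1, (k <= i)%N -> (k <= j)%N ->
      `|schur A k i j| <= `|schur A k (inord k) (inord k)|.

Definition mx_maxnorm (m n : nat) (M : 'M[R]_(m, n)) : R :=
  \big[Num.max/0]_(i < m) \big[Num.max/0]_(j < n) `|M i j|.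

Definition unit_lower_triangular (n : nat) (L : 'M[R]_n) : Prop :=
  (forall i j : 'I_n, (i < j)%N -> L i j = 0) /\ (forall i : 'I_n, L i i = 1).

Definition upper_triangular (n : nat) (U : 'M[R]_n) : Prop :=
  forall i j : 'I_n, (j < i)%N -> U i j = 0.

Definition growth_factor (n : nat) (A L U : 'M[R]_n) : R :=
  Num.max (mx_maxnorm L) (mx_maxnorm U / mx_maxnorm A).

End GrowthDefs.

(* Main.v *)
Require Import Defs.
From HB Require Import structures.
From mathcomp Require Import all_boot all_order all_algebra.
From mathcomp Require Import reals.
From mathcomp Require Import ring lra.
Set Implicit Arguments. Unset Strict Implicit. Unset Printing Implicit Defensive.
Import Order.TTheory GRing.Theory Num.Theory.
Local Open Scope ring_scope.

(* Write p1, ..., p5 for the absolute values of the pivots, and m = p2 / p1, g = p3 / p1,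
   rho = p5 / p3. Each elimination step subtracts a rank-one matrix whose factors have entries
   at most 1 relative to the pivot. An entry of a Schur complement can exceed the previous pivot
   only if the rank-one term has the opposite sign there; call an entry bad if the signs agree.
   A 2 x 2 minor with an odd number of negative entries contains a bad entry, because the signs
   of a rank-one matrix are even. Quantified, this gives g <= m (3 - m) <= 9/4, and rho <= 9/4
   in the same way, so g rho > 4.84 forces both ratios to be nearly extremal.

   Let E = A^(3) / p3. The bad entry h of the 2 x 2 matrix A^(4) singles out a 2 x 2 submatrix
   [[1, - s1], [- s2, h]] of E (up to signs) with rho <= 1 + h + s (1 - s) for s = s1, s2. The
   entries 1 and h are so large that each of them forces an elimination multiplier of the second
   step, in its row or its column, to be at least (x - m) / (m (2 - m)) with x = g, resp.
   x = g h. If these two large multipliers meet at s1 or s2, the resulting entry of A^(2)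
   exceeds p2; otherwise the entry of A^(2) there is bad and exceeds p1. *)

(** * Two elimination steps seen from one large entry *)

Lemma mulB_ge0 (R : realDomainType) (a b c d : R) :
  a <= b -> c <= d -> 0 <= (b - a) * (d - c).
Proof. by move=> ab cd; rewrite mulr_ge0 ?subr_ge0. Qed.

Lemma mul_norm1 (R : realDomainType) (a b : R) :
  -1 <= a <= 1 -> -1 <= b <= 1 -> -1 <= a * b <= 1.
Proof.
rewrite -!ler_norml normrM => a1 b1.
by rewrite (le_trans (ler_wpM2r _ a1)) // mul1r.
Qed.

(** The four products of [v0], [v] with [z0], [z] form a rank-one matrix, and [m > 1] makes
    [v0 * z0] positive. So the case is settled by the signs of [v * z0] and [v0 * z]: equal signs
    force one multiplier to be large, opposite signs force both or are contradictory. *)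
Lemma large_multiplier_trichotomy (R : realFieldType) (m g l u v0 z0 v z : R) :
  1 < m -> m + 1 < m * g -> 0 <= l <= 1 -> 0 <= u <= 1 ->
  -1 <= v0 <= 1 -> -1 <= z0 <= 1 -> -1 <= v <= 1 -> -1 <= z <= 1 ->
  m - v0 * z0 <= 1 -> m * l - v * z0 <= 1 -> m * u + v0 * z <= 1 ->
  g - m * l * u <= m -> g - m * l * u - v * z <= 1 ->
  [\/ [/\ v * z0 <= 0, v0 * z <= 0 & g - m <= m * (2 - m) * u],
      [/\ 0 <= v * z0, 0 <= v0 * z & g - m <= m * (2 - m) * l]
    | g - m <= m * (2 - m) * u /\ g - m <= m * (2 - m) * l].
Proof.
move=> m1 mg /andP[l0 l1] /andP[u0 u1] v0b z0b vb zb.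
move=> H00 H10 H01 Hm H11.
have /andP[_ P1] := mul_norm1 v0b z0b.
have /andP[P10 P10'] := mul_norm1 vb z0b.
have /andP[P01 P01'] := mul_norm1 v0b zb.
have m2 : m <= 2 by lra.
have rk : (v * z0) * (v0 * z) = (v0 * z0) * (v * z) by ring.
move: P1 H00 H10 H01 H11 P10 P01 P10' P01' rk.
set p00 := v0 * z0; set p10 := v * z0; set p01 := v0 * z; set p11 := v * z.
clearbody p00 p10 p01 p11 => P1 H00 H10 H01 H11 P10 P01 P10' P01' rk.
clear v0b z0b vb zb v0 z0 v z.
have p00_gt0 : 0 < p00 by lra.
have m1w := ltW m1.
have hu : 0 <= 1 - (m - 1) * u by have := mulB_ge0 m1w u1; lra.
have hl : 0 <= 1 - (m - 1) * l by have := mulB_ge0 m1w l1; lra.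
(* Otherwise [g <= 1 + m * l * u <= 1 + 1 / m], against [m + 1 < m * g]. *)
have bad0 : ~ (m * l <= 1 /\ m * u <= 1 /\ p11 <= 0).
  move=> [a [b c]].
  have ml0 : 0 <= m * l by rewrite mulr_ge0 //; lra.
  have mu0 : 0 <= m * u by rewrite mulr_ge0 //; lra.
  have ? : (m * l) * (m * u) <= 1 by have := mulB_ge0 a mu0; lra.
  have : m * (g - m * l * u) <= m * 1 by rewrite ler_pM2l; lra.
  lra.
case: (lerP p10 0) => s10; case: (lerP p01 0) => s01.
- constructor 1; split => //.
  (* The excess over 1 is at most [p11], and [p00 * p11 = p10 * p01 <= - p10] passes it on to [p10],
     which lowers the bound [1 + p10] on [m * l]. *)
  have q : (m - 1) * (g - m * l * u - 1) <= - p10.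
    case: (lerP (g - m * l * u) 1) => d1; first by have := mulB_ge0 m1w d1; lra.
    have dp : g - m * l * u - 1 <= p11 by lra.
    have mp : m - 1 <= p00 by lra.
    have := mulB_ge0 s10 P01; have := mulB_ge0 mp (ltW d1).
    by have := mulB_ge0 (ltW p00_gt0) dp; lra.
  (* With the weights [u] and [1 - (m - 1) * u], all terms in [l] cancel. *)
  have := mulr_ge0 u0 (_ : 0 <= 1 - m * l - (m - 1) * (g - m * l * u - 1)).
  have := mulr_ge0 hu (_ : 0 <= m - (g - m * l * u)).
  by rewrite !subr_ge0 => /(_ Hm) ? /(_ _) h; have := h ltac:(lra); lra.
- by exfalso; apply: bad0; split; [lra | split; first lra]; rewrite -(ler_pM2l p00_gt0);
    have := mulB_ge0 s10 (ltW s01); lra.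
- constructor 3.
  have P11 : p11 <= 0.
    by rewrite -(ler_pM2l p00_gt0); have := mulB_ge0 s01 (ltW s10); lra.
  have q : (m * l - 1) * (m * u - 1) <= - p11.
    have pp : p10 * - p01 <= - p11 by have := mulB_ge0 P11 P1; lra.
    case: (lerP (m * l) 1) => a1; case: (lerP (m * u) 1) => b1.
    + by exfalso; apply: bad0.
    + by have := mulB_ge0 a1 (ltW b1); lra.
    + by have := mulB_ge0 (ltW a1) b1; lra.
    have a2 : m * l - 1 <= p10 by lra.
    have b2 : m * u - 1 <= - p01 by lra.
    by have := mulB_ge0 a2 (ltW b1); have := mulB_ge0 (ltW s10) b2; lra.
  have m0 : 0 <= m by lra.
  have l1' : 0 <= 1 - l by lra.
  have u1' : 0 <= 1 - u by lra.
  have := mulr_ge0 l1' (mulr_ge0 m0 hu); have := mulr_ge0 u1' (mulr_ge0 m0 hl).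
  by split; lra.
- constructor 2; split; try lra.
  have q : (m - 1) * (g - m * l * u - 1) <= p01.
    case: (lerP (g - m * l * u) 1) => d1; first by have := mulB_ge0 m1w d1; lra.
    have dp : g - m * l * u - 1 <= p11 by lra.
    have mp : m - 1 <= p00 by lra.
    have := mulB_ge0 (ltW s01) P10'; have := mulB_ge0 mp (ltW d1).
    by have := mulB_ge0 (ltW p00_gt0) dp; lra.
  have := mulr_ge0 l0 (_ : 0 <= 1 - m * u - (m - 1) * (g - m * l * u - 1)).
  have := mulr_ge0 hl (_ : 0 <= m - (g - m * l * u)).
  by rewrite !subr_ge0 => /(_ Hm) ? /(_ _) h; have := h ltac:(lra); lra.
Qed.

(** * Growth estimates from two large multipliers *)

Lemma third_pivot_bound (R : realFieldType) (m g t : R) :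
  1 < m -> m <= 2 -> 2 < g -> t <= 1 -> g - m <= m * (2 - m) * t ->
  m < 2 /\ g <= m * (3 - m).
Proof.
move=> m1 m2 g2 t1 h.
have : 0 <= m * ((2 - m) * (1 - t)).
  by rewrite mulr_ge0 ?mulr_ge0 ?subr_ge0 // (le_trans ler01) // ltW.
move=> h'; have gm : g <= m * (3 - m) by lra.
split=> //; rewrite lt_neqAle m2 andbT; apply/eqP => mE; move: gm; rewrite mE; lra.
Qed.

Lemma mul3Bm_le (R : realFieldType) (m : R) : m * (3 - m) <= 9 / 4.
Proof. by have := sqr_ge0 (m - 3 / 2); lra. Qed.

(** The large multipliers [a] and [b] meet at [s]: the entry there must stay above [- m], so a large
    [a * b] leaves little room for [s]. Here [x] stands for [g * h]. *)
Lemma growth_lt_two_large_multipliers (R : realFieldType) (m g x s a b : R) :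
  1 < m -> m <= 2 -> 2 < g -> 0 <= s -> a <= 1 -> b <= 1 ->
  g - m <= m * (2 - m) * a -> x - m <= m * (2 - m) * b ->
  - m <= g * - s - m * a * b ->
  g + x + g * (s * (1 - s)) < 484%:R / 100%:R.
Proof.
move=> m1 m2 g2 s0 a1 b1 ha hb hs.
have [_ gm] := third_pivot_bound m1 m2 g2 a1 ha.
have g1 := le_trans gm (mul3Bm_le m).
have m0 := ltW (lt_trans ltr01 m1); have g0 : 0 <= g by lra.
have h1 : 0 <= 2 * m - m * (a + b) - g * s.
  have : 0 <= m * ((1 - a) * (1 - b)) by rewrite mulr_ge0 ?mulr_ge0 ?subr_ge0.
  lra.
have h2 : g + x <= 6 * m - 2 * m ^+ 2 - g * s * (2 - m).
  have : 0 <= (2 - m) * (2 * m - m * (a + b) - g * s).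
    by apply: mulr_ge0 => //; rewrite subr_ge0.
  clear - ha hb; lra.
have h3 : g * (s * (m - 1 - s)) <= 9 / 16 * (m - 1) ^+ 2.
  have := mulr_ge0 g0 (sqr_ge0 (m - 1 - 2 * s)).
  have : 0 <= (9 / 4 - g) * (m - 1) ^+ 2 by rewrite mulr_ge0 ?sqr_ge0 ?subr_ge0.
  clear; lra.
(* The bound is now [6 * m - 2 * m ^+ 2 + 9 / 16 * (m - 1) ^+ 2], whose maximum, near 17 / 10, is
   below 4.7. *)
have := sqr_ge0 (m - 17 / 10).
clear - h2 h3 m0; lra.
Qed.

(** The large multipliers [t] and [b] do not meet, but the entry at [s] is bad ([0 <= p]) and must
    stay above -1 instead of [- m]. Its other multiplier [l] is bounded below through the entry
    [g]. *)
Lemma growth_lt_two_bad_multipliers (R : realFieldType) (m g x s l t b p : R) :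
  1 < m -> m <= 2 -> 2 < g -> x <= g -> 0 <= s -> 0 <= l -> t <= 1 -> 0 <= b -> 0 <= p ->
  g - m <= m * (2 - m) * t -> x - m <= m * (2 - m) * b ->
  g - m * l * t <= m -> -1 <= g * - s - m * l * b - p ->
  g + x + g * (s * (1 - s)) < 484%:R / 100%:R.
Proof.
move=> m1 m2w g2 xg s0 l0 t1 b0 p0 ht hb hl hs.
have [m2 gm] := third_pivot_bound m1 m2w g2 t1 ht.
have g94 := le_trans gm (mul3Bm_le m).
have m0 := ltW (lt_trans ltr01 m1); have g0 : 0 <= g by lra.
rewrite ltNge; apply/negP => hk.
have c0 : 0 < m * (2 - m) by rewrite mulr_gt0 ?subr_gt0 // (lt_trans ltr01).
have ha : 0 <= m * l - (g - m).
  have : 0 <= m * (l * (1 - t)) by rewrite mulr_ge0 ?mulr_ge0 ?subr_ge0.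
  clear - hl; lra.
(* With [c = m * (2 - m)], [c * (m * l * b) >= (g - m) * (x - m)], and this product is at least
   [c * ((g - m) + (x - m) - c)] because both factors are at most [c]. *)
have h1 : g * s + (g - m) + (x - m) - m * (2 - m) <= 1.
  rewrite -(ler_pM2l c0).
  have : 0 <= m * (2 - m) * (b * (m * l - (g - m))) by exact: mulr_ge0 (ltW c0) (mulr_ge0 b0 ha).
  have : 0 <= (g - m) * (m * (2 - m) * b - (x - m)).
    by rewrite mulr_ge0 ?subr_ge0 // (le_trans m2w) // ltW.
  have : 0 <= (m * (2 - m) - (g - m)) * (m * (2 - m) - (x - m)).
    by apply: mulr_ge0; clear - gm xg; lra.
  have : 0 <= m * (2 - m) * (1 - g * s - m * l * b).
    by rewrite mulr_ge0 ?(ltW c0) //; clear - hs p0; lra.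
  clear; lra.
have h2 : g * s * s <= 16 / 100 - (2 - m) ^+ 2 by clear - h1 hk; lra.
have h3 : 84 / 100 - 2 * (2 - m) + 2 * (2 - m) ^+ 2 + g * s * s <= g * s.
  by clear - gm xg hk; lra.
have h4 : (g * s) ^+ 2 <= 9 / 4 * (g * s * s).
  have : 0 <= (9 / 4 - g) * (g * s * s) by rewrite !mulr_ge0 ?subr_ge0.
  clear; lra.
(* [h2] and [h4] cap [g * s] at 6 / 10; linearizing there leaves a positive quadratic in [2 - m],
   minimal near 35 / 100. *)
have := sqr_ge0 (g * s - 6 / 10); have := sqr_ge0 (2 - m - 35 / 100).
clear - h2 h3 h4 m1 m2; lra.
Qed.

(** * Entries of E too small to force a multiplier *)

Lemma mulB_le_quarter_sqr (R : realFieldType) (k s : R) : s * (k - s) <= k ^+ 2 / 4.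
Proof. by have := sqr_ge0 (s - k / 2); lra. Qed.

(** The weights [k - s2] and [s2] on the two bounds eliminate [s1]. *)
Lemma small_entry_bound (R : realFieldType) (k s1 s2 t : R) :
  0 < k -> 0 <= s2 <= k -> t <= s2 * (k - s1) -> t <= s1 * (k - s2) ->
  t <= s2 * (k - s2).
Proof.
move=> k0 /andP[s0 sk] h1 h2; rewrite -(ler_pM2l k0).
have : 0 <= (k - s2) * (s2 * (k - s1) - t) by apply: mulr_ge0; lra.
have : 0 <= s2 * (s1 * (k - s2) - t) by apply: mulr_ge0; lra.
lra.
Qed.

(** The threshold [k = m / g] is the size up to which an entry of E forces nothing. Here it bounds
    one trailing entry in each estimate; the final quadratic [5 / 4 * m * (3 - m) + m] peaks at 19 /
    10. *)
Lemma growth_le_small_blocks (R : realFieldType) (m g rho k s1 s2 : R) :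
  k * g = m -> 2 < g -> g <= m * (3 - m) ->
  0 <= s1 <= 1 -> 0 <= s2 <= 1 ->
  rho <= 1 + k + s2 * (1 - s1) -> rho <= 1 + k + s1 * (1 - s2) ->
  g * rho <= 484%:R / 100%:R.
Proof.
move=> kg g2 gm s1b s2b h1 h2.
have h3 : rho - 1 - k <= s2 * (1 - s2).
  by apply: (@small_entry_bound _ 1 s1) => //; lra.
have h4 := mulB_le_quarter_sqr 1 s2.
have : g * rho <= g * (5 / 4 + k) by rewrite ler_pM2l; lra.
have := sqr_ge0 (m - 19 / 10).
lra.
Qed.

(** Here [k] bounds the entries in the pivot row and column, so that [rho <= 2 + k ^+ 2 / 4]. *)
Lemma growth_le_small_borders (R : realFieldType) (m g rho k s1 s2 : R) :
  1 < m < 2 -> k * g = m -> 2 < g -> g <= m * (3 - m) -> 2 < rho ->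
  0 <= s1 -> 0 <= s2 ->
  rho <= 2 + s2 * (k - s1) -> rho <= 2 + s1 * (k - s2) ->
  g * rho <= 484%:R / 100%:R.
Proof.
move=> /andP[m1 m2] kg g2 gm rho2 s1b s2b h1 h2.
have k0 : 0 < k by rewrite -(pmulr_lgt0 _ (_ : 0 < g)); lra.
have sk : s2 <= k.
  rewrite leNgt; apply/negP => ks.
  have : 0 <= s1 * (s2 - k) by apply: mulr_ge0; lra.
  lra.
have h3 : rho - 2 <= s2 * (k - s2).
  by apply: (@small_entry_bound _ k s1); rewrite ?s2b //; lra.
have h4 := mulB_le_quarter_sqr k s2.
have g0 : 0 < g by lra.
have h5 : g * (g * rho) <= 2 * g ^+ 2 + m ^+ 2 / 4.
  have : (g * g) * (rho - 2) <= (g * g) * (k ^+ 2 / 4).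
    by rewrite ler_pM2l ?mulr_gt0 //; lra.
  rewrite -kg; lra.
rewrite -(ler_pM2l g0).
(* Since [2 * g ^+ 2 - 484 / 100 * g] increases on this range, [g] may be replaced by [m * (3 - m)].
   The remaining cubic in [m] has its local maximum near 161 / 100, which [h7] controls. *)
have h6 : 0 <= (m * (3 - m) - g) * (2 * (m * (3 - m) + g) - 484 / 100).
  by apply: mulr_ge0; lra.
have h7 : 0 <= m * ((556 / 100 - 2 * m) * (m - 161 / 100) ^+ 2).
  by apply: mulr_ge0; [lra | apply: mulr_ge0; [lra | exact: sqr_ge0]].
have := sqr_ge0 m; lra.
Qed.

(** The two estimates have different shapes, so they are multiplied; the product regroups into
    [s2 * (k - s2)] and [s1 * (1 - s1)], each at most a quarter of a square. *)
Lemma growth_le_small_mixed (R : realFieldType) (m g rho k s1 s2 : R) :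
  0 < m -> k * g = m -> 215 / 100 <= g -> g <= m * (3 - m) -> 2 < rho ->
  0 <= s1 <= 1 -> 0 <= s2 <= 1 -> 
  rho <= 1 + k + s2 * (1 - s1) -> rho <= 2 + s1 * (k - s2) ->
  g * rho <= 484%:R / 100%:R.
Proof.
move=> m0 kg g2 gm rho2 /andP[s10 s11] /andP[s20 s21] h1 h2.
rewrite leNgt; apply/negP => K.
have g0 : 0 < g by lra.
have g94 : g <= 9 / 4 by have := sqr_ge0 (m - 3 / 2); lra.
have ms : (m - 3 / 2) ^+ 2 <= 1 / 10 by lra.
have m182 : m <= 182 / 100.
  rewrite leNgt; apply/negP => mm.
  have : 0 <= (m - 182 / 100) * (m - 118 / 100) by apply: mulr_ge0; lra.
  lra.
have k0 : 0 < k by rewrite -(pmulr_lgt0 _ g0); lra.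
have sk : s2 <= k.
  rewrite leNgt; apply/negP => ks.
  have : 0 <= s1 * (s2 - k) by apply: mulr_ge0; lra.
  lra.
have a0 : 0 <= rho - 1 - k by rewrite -(pmulr_rge0 _ g0); lra.
have p1 : (rho - 1 - k) * (rho - 2) <= s2 * (1 - s1) * (s1 * (k - s2)).
  by apply: ler_pM; lra.
have p2 : s2 * (1 - s1) * (s1 * (k - s2)) <= k ^+ 2 / 4 * (1 / 4).
  have -> : s2 * (1 - s1) * (s1 * (k - s2)) = (s2 * (k - s2)) * (s1 * (1 - s1)) by ring.
  have h3 := mulB_le_quarter_sqr k s2; have h4 := mulB_le_quarter_sqr 1 s1.
  by apply: ler_pM; rewrite ?mulr_ge0 ?subr_ge0 //; lra.
have p3 : (g * rho - g - m) * (g * rho - 2 * g) <= m ^+ 2 / 16.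
  have -> : (g * rho - g - m) * (g * rho - 2 * g) = g ^+ 2 * ((rho - 1 - k) * (rho - 2)).
    by rewrite -kg; ring.
  have -> : m ^+ 2 / 16 = g ^+ 2 * (k ^+ 2 / 4 * (1 / 4)) by rewrite -kg; field.
  by rewrite ler_pM2l ?exprn_gt0 //; lra.
(* From [g <= 9 / 4] and [484 / 100 < g * rho]; 34 / 100 is 484 / 100 minus twice 9 / 4. *)
have p4 : (484 / 100 - 225/100 - m) * (34 / 100) <= (g * rho - g - m) * (g * rho - 2 * g).
  by apply: ler_pM; lra.
have : 0 <= (182 / 100 - m) * (m + 8) by apply: mulr_ge0; lra.
lra.
Qed.

(** If each pair had an entry of size at most [m / g], one of the three preceding estimates would
    apply, the mixed one also with [s1] and [s2] exchanged. A large pair is what later fixes signs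
    of multipliers. *)
Lemma large_entries_dichotomy (R : realFieldType) (m g rho h s1 s2 h13 h33 h21 h22 : R) :
  1 < m < 2 -> 215 / 100 <= g -> g <= m * (3 - m) -> 2 < rho ->
  484%:R / 100%:R < g * rho ->
  0 <= s1 <= 1 -> 0 <= s2 <= 1 -> h <= 1 ->
  h13 <= 1 -> h33 <= 1 -> h21 <= 1 -> h22 <= 1 ->
  rho <= h33 + s2 * h13 + (h - s1 * s2) -> rho <= h22 + s1 * h21 + (h - s1 * s2) ->
  (m < g * h13 /\ m < g * h33) \/ (m < g * h21 /\ m < g * h22).
Proof.
move=> mb g215 gm rho2 K s1b s2b h1 h131 h331 h211 h221 i1 i2.
have g0 : 0 < g by lra.
have g2 : 2 < g by lra.
have m0 : 0 < m by lra.
pose k := m / g.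
have kg : k * g = m by rewrite /k divfK ?gt_eqF.
have cvt (x : R) : g * x <= m -> x <= k by rewrite -kg mulrC ler_pM2r.
have mono (s x y : R) : 0 <= s <= 1 -> x <= y -> s * x <= s * y.
  by move=> /andP[? _] ?; rewrite ler_wpM2l.
case: (lerP (g * h13) m) => [/cvt k13|t13]; last first.
  case: (lerP (g * h33) m) => [/cvt k33|t33]; last by left.
  right; split; rewrite ltNge; apply/negP => /cvt kk; move: K; apply/negP; rewrite -leNgt.
  - apply: (@growth_le_small_mixed _ m g rho k s1 s2) => //.
    + by have := mono _ _ _ s2b h131; lra.
    + by have := mono _ _ _ s1b kk; lra.
  - apply: (@growth_le_small_blocks _ m g rho k s1 s2) => //.
    + by have := mono _ _ _ s2b h131; lra.
    + by have := mono _ _ _ s1b h211; lra.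
right; split; rewrite ltNge; apply/negP => /cvt kk; move: K; apply/negP; rewrite -leNgt.
- apply: (@growth_le_small_borders _ m g rho k s1 s2) => //; try lra.
  + by have := mono _ _ _ s2b k13; lra.
  + by have := mono _ _ _ s1b kk; lra.
- apply: (@growth_le_small_mixed _ m g rho k s2 s1) => //.
  + by have := mono _ _ _ s1b h211; lra.
  + by have := mono _ _ _ s2b k13; lra.
Qed.

(** * Combining the multiplier cases, and removing the sign normalization *)

Lemma growth_lt_nonneg_multipliers (R : realFieldType)
    (m g x s1 s2 l1 l2 u1 u2 v0 v1 v2 z0 z1 z2 : R) :
  1 < m -> 2 < g -> 2 < x -> x <= g -> 0 <= s1 -> 0 <= s2 ->
  0 <= l1 <= 1 -> 0 <= l2 <= 1 -> 0 <= u1 <= 1 -> 0 <= u2 <= 1 ->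
  -1 <= v0 <= 1 -> -1 <= v1 <= 1 -> -1 <= v2 <= 1 ->
  -1 <= z0 <= 1 -> -1 <= z1 <= 1 -> -1 <= z2 <= 1 ->
  m - v0 * z0 <= 1 ->
  m * l1 - v1 * z0 <= 1 -> m * l2 - v2 * z0 <= 1 ->
  m * u1 + v0 * z1 <= 1 -> m * u2 + v0 * z2 <= 1 ->
  g - m * l1 * u1 <= m -> g - m * l1 * u1 - v1 * z1 <= 1 ->
  x - m * l2 * u2 <= m -> x - m * l2 * u2 - v2 * z2 <= 1 ->
  - m <= g * - s1 - m * l1 * u2 -> -1 <= g * - s1 - m * l1 * u2 - v1 * z2 ->
  - m <= g * - s2 - m * l2 * u1 -> -1 <= g * - s2 - m * l2 * u1 - v2 * z1 ->
  g + x + g * (s1 * (1 - s1)) < 484%:R / 100%:R \/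
  g + x + g * (s2 * (1 - s2)) < 484%:R / 100%:R.
Proof.
move=> m1 g2 x2 xg s10 s20 l1b l2b u1b u2b v0b v1b v2b z0b z1b z2b.
move=> H00 H10 H20 H01 H02 B11 A11 B22 A22 B12 A12 B21 A21.
have mg (t : R) : 2 < t -> m + 1 < m * t.
  move=> t2; apply: (@lt_trans _ _ (m * 2)); last by rewrite ltr_pM2l ?(lt_trans ltr01).
  by rewrite mulr_natr mulr2n ltrD2l.
have p00 : 0 < v0 * z0 by rewrite -subr_gt0 in m1; apply: lt_le_trans m1 _; rewrite lerBlDr addrC -lerBlDr.
have m2 : m <= 2.
  have : v0 * z0 <= 1 by have /andP[] := mul_norm1 v0b z0b.
  clear - H00; lra.
have T1 := large_multiplier_trichotomy m1 (mg _ g2) l1b u1b v0b z0b v1b z1b H00 H10 H01 B11 A11.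
have T2 := large_multiplier_trichotomy m1 (mg _ x2) l2b u2b v0b z0b v2b z2b H00 H20 H02 B22 A22.
have [/andP[l10 l11] /andP[l20 l21]] := (l1b, l2b).
have [/andP[u10 u11] /andP[u20 u21]] := (u1b, u2b).
have key1 := growth_lt_two_large_multipliers (m := m) (g := g) (x := x) (s := s1) (a := l1) (b := u2).
have key2 := growth_lt_two_large_multipliers (m := m) (g := g) (x := x) (s := s2) (a := u1) (b := l2).
rewrite [m * u1 * l2]mulrAC in key2.
(* In seven of the nine combinations two large multipliers meet off the diagonal. The others have
   only [u1], [u2] or only [l1], [l2]; there the recorded signs and rank one make the off-diagonal
   entry bad. *)
case: T1 => [[n10 n01 w1]|[n10 n01 w1]|[wu1 wl1]];
  case: T2 => [[n20 n02 w2]|[n20 n02 w2]|[wu2 wl2]];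
  try by [left; apply: key1 | right; apply: key2].
- left; apply: (growth_lt_two_bad_multipliers (m := m) (l := l1) (t := u1) (b := u2) (p := v1 * z2)) => //.
  rewrite -(pmulr_rge0 _ p00).
  have -> : v0 * z0 * (v1 * z2) = (v1 * z0) * (v0 * z2) by ring.
  by rewrite mulr_le0.
- right; rewrite [m * l1 * u1]mulrAC in B11; rewrite [m * l2 * u1]mulrAC in A21.
  apply: (growth_lt_two_bad_multipliers (m := m) (l := u1) (t := l1) (b := l2) (p := v2 * z1)) => //.
  rewrite -(pmulr_rge0 _ p00).
  have -> : v0 * z0 * (v2 * z1) = (v2 * z0) * (v0 * z1) by ring.
  by rewrite mulr_ge0.
Qed.

Lemma norm_sgM (R : realDomainType) (e x : R) : e != 0 -> `|Num.sg e * x| = `|x|.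
Proof. by move=> e0; rewrite normrM normr_sg e0 mul1r. Qed.

Lemma sgM_ge0 (R : realDomainType) (x y : R) : y != 0 -> 0 <= x * y -> Num.sg y * x = `|x|.
Proof.
case: (ltgtP y 0) => // y0 _ h; first by rewrite ltr0_sg // ler0_norm ?mulN1r // -(nmulr_lge0 _ y0).
by rewrite gtr0_sg // ger0_norm ?mul1r // -(pmulr_lge0 _ y0).
Qed.

Lemma sgM_le0 (R : realDomainType) (x y : R) : y != 0 -> x * y <= 0 -> Num.sg y * x = - `|x|.
Proof.
move=> y0 h; have := @sgM_ge0 _ (- x) y y0; rewrite mulNr oppr_ge0 normrN => /(_ h) <-.
by rewrite mulrN opprK.
Qed.

(* Flipping the signs of rows and columns makes the multipliers nonnegative. *)
Lemma growth_lt_multipliers (R : realFieldType)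
    (m g e12 e21 e22 l1 l2 u1 u2 v0 v1 v2 z0 z1 z2 : R) :
  1 < m -> 2 < g -> 2 < g * `|e22| -> `|e22| <= 1 ->
  `|l1| <= 1 -> `|l2| <= 1 -> `|u1| <= 1 -> `|u2| <= 1 ->
  `|v0| <= 1 -> `|v1| <= 1 -> `|v2| <= 1 -> `|z0| <= 1 -> `|z1| <= 1 -> `|z2| <= 1 ->
  `|m - v0 * z0| <= 1 ->
  `|m * l1 - v1 * z0| <= 1 -> `|m * l2 - v2 * z0| <= 1 ->
  `|m * u1 + v0 * z1| <= 1 -> `|m * u2 + v0 * z2| <= 1 ->
  `|g - m * l1 * u1| <= m -> `|g - m * l1 * u1 - v1 * z1| <= 1 ->
  `|g * e22 - m * l2 * u2| <= m -> `|g * e22 - m * l2 * u2 - v2 * z2| <= 1 ->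
  `|g * e12 - m * l1 * u2| <= m -> `|g * e12 - m * l1 * u2 - v1 * z2| <= 1 ->
  `|g * e21 - m * l2 * u1| <= m -> `|g * e21 - m * l2 * u1 - v2 * z1| <= 1 ->
  0 < l1 * u1 -> 0 < e22 * (l2 * u2) -> e12 * (l1 * u2) <= 0 -> e21 * (l2 * u1) <= 0 ->
  g + g * `|e22| + g * (`|e12| * (1 - `|e12|)) < 484%:R / 100%:R \/
  g + g * `|e22| + g * (`|e21| * (1 - `|e21|)) < 484%:R / 100%:R.
Proof.
move=> m1 g2 x2 e1 Nl1 Nl2 Nu1 Nu2 Nv0 Nv1 Nv2 Nz0 Nz1 Nz2.
move=> H00 H10 H20 H01 H02 B11 A11 B22 A22 B12 A12 B21 A21 s11 s22 s12 s21.
have l1n : l1 != 0 by apply: contraTneq s11 => ->; rewrite mul0r ltxx.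
have u1n : u1 != 0 by apply: contraTneq s11 => ->; rewrite mulr0 ltxx.
have l2n : l2 != 0 by apply: contraTneq s22 => ->; rewrite mul0r mulr0 ltxx.
have u2n : u2 != 0 by apply: contraTneq s22 => ->; rewrite !mulr0 ltxx.
have sgn (l u e v z : R) : l != 0 -> u != 0 ->
   g * (Num.sg (l * u) * e) - m * `|l| * `|u| - Num.sg l * v * (Num.sg u * z) =
   Num.sg (l * u) * (g * e - m * l * u - v * z).
  by move=> ln un; rewrite [`|l|]normrEsg [`|u|]normrEsg sgrM; ring.
have sgn0 (l u e : R) : l != 0 -> u != 0 ->
   g * (Num.sg (l * u) * e) - m * `|l| * `|u| = Num.sg (l * u) * (g * e - m * l * u).
  by move=> ln un; rewrite [`|l|]normrEsg [`|u|]normrEsg sgrM; ring.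
have flip (l u e b : R) : l != 0 -> u != 0 -> `|g * e - m * l * u| <= b ->
   - b <= g * (Num.sg (l * u) * e) - m * `|l| * `|u| <= b.
  by move=> ln un h; rewrite -ler_norml sgn0 // norm_sgM // mulf_neq0.
have flipz (l u e v z b : R) : l != 0 -> u != 0 -> `|g * e - m * l * u - v * z| <= b ->
   - b <= g * (Num.sg (l * u) * e) - m * `|l| * `|u| - Num.sg l * v * (Num.sg u * z) <= b.
  by move=> ln un h; rewrite -ler_norml sgn // norm_sgM // mulf_neq0.
(* After flipping, the block of E reads 1, [- |e12|], [- |e21|], [|e22|]. *)
have E11 : Num.sg (l1 * u1) * 1 = 1 by rewrite gtr0_sg // mulr1.
have E22 : Num.sg (l2 * u2) * e22 = `|e22| by apply: sgM_ge0; rewrite ?mulf_neq0 // ltW.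
have E12 : Num.sg (l1 * u2) * e12 = - `|e12| by apply: sgM_le0; rewrite ?mulf_neq0.
have E21 : Num.sg (l2 * u1) * e21 = - `|e21| by apply: sgM_le0; rewrite ?mulf_neq0.
have nz (a b : R) : `|a| <= 1 -> b != 0 -> -1 <= Num.sg b * a <= 1.
  by move=> h bn; rewrite -ler_norml norm_sgM.
have row (l v : R) : l != 0 -> `|m * l - v * z0| <= 1 -> m * `|l| - Num.sg l * v * z0 <= 1.
  move=> ln; rewrite -(norm_sgM _ ln) ler_norml => /andP[_]; rewrite [`|l|]normrEsg; clear; lra.
have col (u z : R) : u != 0 -> `|m * u + v0 * z| <= 1 -> m * `|u| + v0 * (Num.sg u * z) <= 1.
  move=> un; rewrite -(norm_sgM _ un) ler_norml => /andP[_]; rewrite [`|u|]normrEsg; clear; lra.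
rewrite -[g in `|g - _ | <= _]mulr1 in B11; rewrite -[g in `|g - _ - _| <= _]mulr1 in A11.
have /andP[_ b11] := flip _ _ _ _ l1n u1n B11; have /andP[_ a11] := flipz _ _ _ _ _ _ l1n u1n A11.
have /andP[_ b22] := flip _ _ _ _ l2n u2n B22; have /andP[_ a22] := flipz _ _ _ _ _ _ l2n u2n A22.
have /andP[b12 _] := flip _ _ _ _ l1n u2n B12; have /andP[a12 _] := flipz _ _ _ _ _ _ l1n u2n A12.
have /andP[b21 _] := flip _ _ _ _ l2n u1n B21; have /andP[a21 _] := flipz _ _ _ _ _ _ l2n u1n A21.
rewrite E11 ?mulr1 in b11 a11; rewrite E22 in b22 a22.
rewrite E12 in b12 a12; rewrite E21 in b21 a21.
apply: (@growth_lt_nonneg_multipliers _ m g (g * `|e22|) `|e12| `|e21| `|l1| `|l2| `|u1| `|u2|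
         v0 (Num.sg l1 * v1) (Num.sg l2 * v2) z0 (Num.sg u1 * z1) (Num.sg u2 * z2));
  rewrite ?normr_ge0 ?nz -?ler_norml ?row ?col //.
- by rewrite ler_piMr // (le_trans _ (ltW g2)).
- by move: H00; rewrite ler_norml => /andP[].
Qed.

(** From [g <= m + m * (l * u)] and [m <= 2 < g], the multipliers have equal signs and [m > 1].
    After flipping, every branch of the trichotomy bounds [g]. *)
Lemma third_pivot_bound_signed (R : realFieldType) (m g l u v0 z0 v z : R) :
  0 <= m -> 2 < g -> `|l| <= 1 -> `|u| <= 1 ->
  `|v0| <= 1 -> `|z0| <= 1 -> `|v| <= 1 -> `|z| <= 1 ->
  `|m - v0 * z0| <= 1 -> `|m * l - v * z0| <= 1 -> `|m * u + v0 * z| <= 1 ->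
  `|g - m * l * u| <= m -> `|g - m * l * u - v * z| <= 1 ->
  [/\ 1 < m, m < 2 & g <= m * (3 - m)].
Proof.
move=> m0 g2 Nl Nu Nv0 Nz0 Nv Nz H00 H10 H01 B A.
rewrite !ler_norml in H00 Nv0 Nz0; have /andP[_ {}H00] := H00.
have m2 : m <= 2 by have /andP[_ ?] := mul_norm1 Nv0 Nz0; lra.
have gmlu : g - m <= m * (l * u).
  by move: B; rewrite ler_norml => /andP[_ ?]; lra.
have lu0 : 0 < l * u.
  rewrite ltNge; apply/negP => lu; have : 0 <= m * - (l * u) by rewrite mulr_ge0 ?oppr_ge0.
  lra.
have lu1 : l * u <= 1.
  by move: Nl Nu; rewrite !ler_norml => a b; have /andP[] := mul_norm1 a b.
have m1 : 1 < m.
  have : 0 <= m * (1 - l * u) by rewrite mulr_ge0 ?subr_ge0.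
  lra.
have ln : l != 0 by apply: contraTneq lu0 => ->; rewrite mul0r ltxx.
have un : u != 0 by apply: contraTneq lu0 => ->; rewrite mulr0 ltxx.
have luE : `|l| * `|u| = l * u by rewrite -normrM gtr0_norm.
have ss : Num.sg l * Num.sg u = 1 by rewrite -sgrM gtr0_sg.
have mg : m + 1 < m * g.
  have : 0 <= (m - 1) * (g - 2) by rewrite mulr_ge0 ?subr_ge0 // ltW.
  clear - m1 g2; lra.
have nz (a b : R) : `|a| <= 1 -> b != 0 -> -1 <= Num.sg b * a <= 1.
  by move=> h bn; rewrite -ler_norml norm_sgM.
have H10' : m * `|l| - Num.sg l * v * z0 <= 1.
  move: H10; rewrite -(norm_sgM _ ln) ler_norml => /andP[_]; rewrite [`|l|]normrEsg; clear; lra.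
have H01' : m * `|u| + v0 * (Num.sg u * z) <= 1.
  move: H01; rewrite -(norm_sgM _ un) ler_norml => /andP[_]; rewrite [`|u|]normrEsg; clear; lra.
have B' : g - m * `|l| * `|u| <= m.
  by move: B; rewrite ler_norml -[m * `|l| * _]mulrA luE mulrA => /andP[].
have A' : g - m * `|l| * `|u| - Num.sg l * v * (Num.sg u * z) <= 1.
  move: A; rewrite ler_norml -[m * `|l| * _]mulrA luE.
  have -> : Num.sg l * v * (Num.sg u * z) = (Num.sg l * Num.sg u) * (v * z) by ring.
  by rewrite ss mul1r mulrA => /andP[].
have bl : 0 <= `|l| <= 1 by rewrite normr_ge0.
have bu : 0 <= `|u| <= 1 by rewrite normr_ge0.
have [/andP[_ l1] /andP[_ u1]] := (bl, bu).
case: (large_multiplier_trichotomy m1 mg bl bu Nv0 Nz0 (nz _ _ Nv ln) (nz _ _ Nz un) H00 H10' H01' B' A').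
- by case=> _ _ /(third_pivot_bound m1 m2 g2 u1) [].
- by case=> _ _ /(third_pivot_bound m1 m2 g2 l1) [].
- by case=> /(third_pivot_bound m1 m2 g2 u1) [].
Qed.

(** * Sign patterns around the bad entry *)

Lemma opposite_signs_of_gt1 (R : realDomainType) (x y : R) :
  `|x| <= 1 -> `|y| <= 1 -> 1 < `|x - y| -> x * y < 0.
Proof.
move=> x1 y1; rewrite !ltNge; apply: contra => xy.
move: x1 y1; rewrite !ler_norml => /andP[x0 x1] /andP[y0 y1].
case: (ltgtP x 0) => [x_lt|x_gt|x_0].
- by rewrite nmulr_rge0 // in xy; apply/andP; split; lra.
- by rewrite pmulr_rge0 // in xy; apply/andP; split; lra.
- by rewrite x_0; apply/andP; split; lra.
Qed.

Lemma same_sign_of_pivoted (R : realFieldType) (m g e l u : R) :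
  0 < m -> m < g * `|e| -> `|g * e - m * l * u| <= m -> 0 < e * (l * u).
Proof.
move=> m0 ge; case: (ltgtP e 0) => [e0|e0|e0]; last by move: ge; rewrite e0 normr0 mulr0 ltNge ltW.
- rewrite ltr0_norm // in ge; rewrite ler_norml nmulr_rgt0 // => /andP[h _].
  by rewrite -(pmulr_rlt0 _ m0); lra.
- rewrite gtr0_norm // in ge; rewrite ler_norml pmulr_rgt0 // => /andP[_ h].
  by rewrite -(pmulr_rgt0 _ m0); lra.
Qed.

(* Two elimination steps on a matrix scaled to have largest entry 1, after fixing signs:
   the first Schur complement is [[m, - m u], [m l, g E - m l u]], with m its pivot and g E the
   second Schur complement, and subtracting the rank-one matrix (v0, v) (z0, z) from it gives
   back the trailing block of the matrix. *)
Record two_steps (R : realFieldType) (I J : Type) (E : I -> J -> R) (l v : I -> R)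
    (u z : J -> R) (m g v0 z0 : R) : Prop := TwoSteps {
  ts_l : forall i, `|l i| <= 1;
  ts_u : forall j, `|u j| <= 1;
  ts_v : forall i, `|v i| <= 1;
  ts_z : forall j, `|z j| <= 1;
  ts_v0 : `|v0| <= 1;
  ts_z0 : `|z0| <= 1;
  ts_pivot : `|m - v0 * z0| <= 1;
  ts_col : forall i, `|m * l i - v i * z0| <= 1;
  ts_row : forall j, `|m * u j + v0 * z j| <= 1;
  ts_schur : forall i j, `|g * E i j - m * l i * u j| <= m;
  ts_block : forall i j, `|g * E i j - m * l i * u j - v i * z j| <= 1
}.

Lemma two_steps_pivot_bound (R : realFieldType) (I J : Type) (E : I -> J -> R) (l v : I -> R)
    (u z : J -> R) (m g v0 z0 : R) (i : I) (j : J) :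
  two_steps E l v u z m g v0 z0 -> 2 < g -> E i j = 1 ->
  [/\ 1 < m, m < 2 & g <= m * (3 - m)].
Proof.
case=> Nl Nu Nv Nz Nv0 Nz0 H00 Hl Hu HB HA g2 E1.
have HBij := HB i j; have HAij := HA i j; rewrite E1 mulr1 in HBij HAij.
exact: third_pivot_bound_signed (le_trans (normr_ge0 _) HBij) g2 (Nl i) (Nu j) Nv0 Nz0 (Nv i)
  (Nz j) H00 (Hl i) (Hu j) HBij HAij.
Qed.

(** The differences [E i j - E i c1 * E r1 j] are A^(4) divided by the third pivot, [r] is p4 / p3,
    and the bad entry sits at [(r3, c2)]. The product [rho * r] is the size of the 2 x 2
    determinant. *)
Lemma growth_of_bad_entry (R : realFieldType) (I J : Type) (E : I -> J -> R) (l v : I -> R)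
    (u z : J -> R) (m g v0 z0 rho r : R) (r1 r2 r3 : I) (c1 c2 c3 : J) :
  two_steps E l v u z m g v0 z0 -> 2 < g -> 2 < rho -> 0 < r -> 484%:R / 100%:R < g * rho ->
  (forall i j, `|E i j| <= 1) -> E r1 c1 = 1 ->
  (forall i j, `|E i j - E i c1 * E r1 j| <= r) ->
  rho * r <= `|E r2 c2 - E r2 c1 * E r1 c2| * `|E r3 c3 - E r3 c1 * E r1 c3| +
             `|E r2 c3 - E r2 c1 * E r1 c3| * `|E r3 c2 - E r3 c1 * E r1 c2| ->
  0 <= (E r3 c2 - E r3 c1 * E r1 c2) * (E r3 c1 * E r1 c2) -> False.
Proof.
move=> ts g2 rho2 r0 K NE E11 HS det bad.
have [m1 m2 gm] := two_steps_pivot_bound ts g2 E11.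
case: ts => Nl Nu Nv Nz Nv0 Nz0 H00 Hl Hu HB HA.
have HB11 := HB r1 c1; have HA11 := HA r1 c1; rewrite E11 mulr1 in HB11 HA11.
have g94 := le_trans gm (mul3Bm_le m).
have g0 : 0 < g by lra.
have m_gt0 : 0 < m by lra.
(* Badness means that the two summands have no opposite signs, so absolute values add. *)
have h32E : `|E r3 c2| = `|E r3 c2 - E r3 c1 * E r1 c2| + `|E r3 c1| * `|E r1 c2|.
  rewrite -normrM -{1}[E r3 c2](subrK (E r3 c1 * E r1 c2)).
  case: (ler0P (E r3 c1 * E r1 c2)) => [p|p].
    case: (eqVneq (E r3 c1 * E r1 c2) 0) => [->|pn]; first by rewrite oppr0 !addr0.
    have pl : E r3 c1 * E r1 c2 < 0 by rewrite lt_neqAle pn.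
    rewrite nmulr_lge0 // in bad.
    by rewrite !ler0_norm ?opprD // -[leRHS]addr0 lerD.
  by rewrite pmulr_lge0 // in bad; rewrite !ger0_norm // addr_ge0 // ltW.
have h321 := NE r3 c2.
have prod1 (a b : R) : `|a| <= 1 -> `|b| <= 1 -> `|a * b| <= 1.
  by move=> a1 b1; rewrite normrM -[1]mulr1 ler_pM.
have rhoD : rho <= `|E r3 c3 - E r3 c1 * E r1 c3| + `|E r3 c2 - E r3 c1 * E r1 c2|.
  rewrite -(ler_pM2r r0); apply: le_trans det _; rewrite mulrDl lerD //.
    by rewrite mulrC ler_wpM2l.
  by rewrite mulrC ler_wpM2l.
have rhoR : rho <= `|E r2 c2 - E r2 c1 * E r1 c2| + `|E r3 c2 - E r3 c1 * E r1 c2|.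
  rewrite -(ler_pM2r r0); apply: le_trans det _; rewrite mulrDl lerD //.
    by rewrite ler_wpM2l.
  by rewrite mulrC ler_wpM2l.
have e1 : `|E r3 c2 - E r3 c1 * E r1 c2| <= 1.
  by have := mulr_ge0 (normr_ge0 (E r3 c1)) (normr_ge0 (E r1 c2)); clear - h321 h32E; lra.
have sD : E r3 c3 * (E r3 c1 * E r1 c3) < 0.
  by apply: opposite_signs_of_gt1; rewrite ?prod1 //; clear - rhoD e1 rho2; lra.
have sR : E r2 c2 * (E r2 c1 * E r1 c2) < 0.
  by apply: opposite_signs_of_gt1; rewrite ?prod1 //; clear - rhoR e1 rho2; lra.
have i1 : rho <= `|E r3 c3| + `|E r3 c1| * `|E r1 c3| +
                 (`|E r3 c2| - `|E r1 c2| * `|E r3 c1|).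
  have := ler_normB (E r3 c3) (E r3 c1 * E r1 c3); rewrite [in leRHS]normrM.
  clear - rhoD h32E; lra.
have i2 : rho <= `|E r2 c2| + `|E r1 c2| * `|E r2 c1| +
                 (`|E r3 c2| - `|E r1 c2| * `|E r3 c1|).
  have := ler_normB (E r2 c2) (E r2 c1 * E r1 c2); rewrite [in leRHS]normrM.
  clear - rhoR h32E; lra.
have bs1 : 0 <= `|E r1 c2| <= 1 by rewrite normr_ge0 NE.
have bs2 : 0 <= `|E r3 c1| <= 1 by rewrite normr_ge0 NE.
have [/andP[s10 s11] /andP[s20 s21]] := (bs1, bs2).
have j1 : rho - 1 - `|E r3 c2| <= `|E r3 c1| * (1 - `|E r1 c2|).
  have := ler_wpM2l s20 (NE r1 c3); have := NE r3 c3; clear - i1; lra.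
have j2 : rho - 1 - `|E r3 c2| <= `|E r1 c2| * (1 - `|E r3 c1|).
  have := ler_wpM2l s10 (NE r2 c1); have := NE r2 c2; clear - i2; lra.
have t2 := small_entry_bound ltr01 bs2 j1 j2.
have t1 := small_entry_bound ltr01 bs1 j2 j1.
(* With [g <= 9 / 4] this puts [g * h] above 2 for [h = |E r3 c2|], and [h <= 1] puts [g] above 215
   / 100. *)
have rh : rho <= 5 / 4 + `|E r3 c2|.
  by have := mulB_le_quarter_sqr 1 `|E r3 c1|; clear - t2; lra.
have gh : g * rho <= g * (5 / 4) + g * `|E r3 c2| by rewrite -mulrDr ler_pM2l.
have gh1 : g * `|E r3 c2| <= g by rewrite ler_piMr // ltW.
have x2 : 2 < g * `|E r3 c2| by clear - gh g94 K; lra.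
have g215 : 215 / 100 <= g by clear - gh gh1 K; lra.
have p11 : 0 < l r1 * u c1.
  have := @same_sign_of_pivoted _ m g 1 (l r1) (u c1) m_gt0.
  by rewrite normr1 mulr1 mul1r; apply => //; lra.
have p32 : 0 < E r3 c2 * (l r3 * u c2).
  by apply: same_sign_of_pivoted (HB _ _) => //; apply: lt_trans x2.
have bad' : 0 <= E r3 c2 * (E r3 c1 * E r1 c2).
  rewrite -[E r3 c2](subrK (E r3 c1 * E r1 c2)) mulrDl addr_ge0 //.
  by rewrite -expr2 sqr_ge0.
have mb : 1 < m < 2 by rewrite m1.
(* By [q] the two quantities have no opposite signs, so it suffices that one is negative. This
   follows from the large pair in column [c3] with [sD], or from the one in row [r2] with [sR]. *)
have [s12 s31] : E r1 c2 * (l r1 * u c2) <= 0 /\ E r3 c1 * (l r3 * u c1) <= 0.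
  have q : 0 <= (E r1 c2 * (l r1 * u c2)) * (E r3 c1 * (l r3 * u c1)).
    have e32 : 0 < E r3 c2 ^+ 2.
      rewrite exprn_even_gt0 //=; apply: contraTneq p32 => ->; by rewrite mul0r ltxx.
    rewrite -(pmulr_rge0 _ e32).
    have -> : E r3 c2 ^+ 2 * (E r1 c2 * (l r1 * u c2) * (E r3 c1 * (l r3 * u c1))) =
      (E r3 c2 * (E r3 c1 * E r1 c2)) * (E r3 c2 * (l r3 * u c2)) * (l r1 * u c1) by ring.
    by apply: mulr_ge0; [apply: mulr_ge0 => // |]; apply: ltW.
  have [[k13 k33]|[k21 k22]] := large_entries_dichotomy mb g215 gm rho2 K bs1 bs2 h321
    (NE r1 c3) (NE r3 c3) (NE r2 c1) (NE r2 c2) i1 i2.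
  - have p13 := same_sign_of_pivoted m_gt0 k13 (HB _ _).
    have p33 := same_sign_of_pivoted m_gt0 k33 (HB _ _).
    have n : E r3 c1 * (l r3 * u c1) < 0.
      have := mulr_gt0 (mulr_gt0 p13 p33) p11.
      have -> : E r1 c3 * (l r1 * u c3) * (E r3 c3 * (l r3 * u c3)) * (l r1 * u c1) =
        (E r3 c3 * (E r3 c1 * E r1 c3)) * (E r3 c1 * (l r3 * u c1)) * ((l r1 * u c3) / E r3 c1) ^+ 2.
        by field; apply: contraTneq sD => ->; rewrite mul0r mulr0 ltxx.
      rewrite -mulrA nmulr_rgt0 //; rewrite pmulr_llt0 //.
      rewrite exprn_even_gt0 //= mulf_neq0 ?invr_eq0 //.
        by apply: contraTneq p13 => ->; rewrite mulr0 ltxx.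
      by apply: contraTneq sD => ->; rewrite mul0r mulr0 ltxx.
    by rewrite nmulr_lge0 // in q; split=> //; apply: ltW.
  - have p21 := same_sign_of_pivoted m_gt0 k21 (HB _ _).
    have p22 := same_sign_of_pivoted m_gt0 k22 (HB _ _).
    have n : E r1 c2 * (l r1 * u c2) < 0.
      have := mulr_gt0 (mulr_gt0 p21 p22) p11.
      have -> : E r2 c1 * (l r2 * u c1) * (E r2 c2 * (l r2 * u c2)) * (l r1 * u c1) =
        (E r2 c2 * (E r2 c1 * E r1 c2)) * (E r1 c2 * (l r1 * u c2)) * ((l r2 * u c1) / E r1 c2) ^+ 2.
        by field; apply: contraTneq sR => ->; rewrite !mulr0 ltxx.
      rewrite -mulrA nmulr_rgt0 //; rewrite pmulr_llt0 //.
      rewrite exprn_even_gt0 //= mulf_neq0 ?invr_eq0 //.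
        by apply: contraTneq p21 => ->; rewrite mulr0 ltxx.
      by apply: contraTneq sR => ->; rewrite !mulr0 ltxx.
    by rewrite nmulr_rge0 // in q; split=> //; apply: ltW.
have := growth_lt_multipliers m1 g2 x2 h321 (Nl r1) (Nl r3) (Nu c1) (Nu c2) Nv0 (Nv r1) (Nv r3)
  Nz0 (Nz c1) (Nz c2) H00 (Hl r1) (Hl r3) (Hu c1) (Hu c2) HB11 HA11
  (HB r3 c2) (HA r3 c2) (HB r1 c2) (HA r1 c2) (HB r3 c1) (HA r3 c1) p11 p32 s12 s31.
rewrite -(ler_pM2l g0) in t1; rewrite -(ler_pM2l g0) in t2.
by clear - t1 t2 K; case; lra.
Qed.

(** The four terms multiply to the product of the entries times a square. *)
Lemma bad_entry_exists (R : realDomainType) (a11 a12 a21 a22 l1 l2 u1 u2 : R) :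
  (a11 * a22) * (a12 * a21) <= 0 ->
  [\/ 0 <= a11 * (l1 * u1), 0 <= a12 * (l1 * u2), 0 <= a21 * (l2 * u1) | 0 <= a22 * (l2 * u2)].
Proof.
move=> odd.
case: (lerP 0 (a11 * (l1 * u1))) => n11; first by constructor 1.
case: (lerP 0 (a12 * (l1 * u2))) => n12; first by constructor 2.
case: (lerP 0 (a21 * (l2 * u1))) => n21; first by constructor 3.
case: (lerP 0 (a22 * (l2 * u2))) => n22; first by constructor 4.
exfalso.
have : 0 < (a11 * (l1 * u1)) * (a22 * (l2 * u2)) * ((a12 * (l1 * u2)) * (a21 * (l2 * u1))).
  by rewrite mulr_gt0 // nmulr_rgt0.
have -> : (a11 * (l1 * u1)) * (a22 * (l2 * u2)) * ((a12 * (l1 * u2)) * (a21 * (l2 * u1))) =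
  (a11 * a22) * (a12 * a21) * (l1 * l2 * u1 * u2) ^+ 2 by ring.
by rewrite ltNge mulr_le0_ge0 // sqr_ge0.
Qed.

Lemma odd_minor_of_large_det (R : realDomainType) (x y r : R) :
  0 <= r -> `|x| <= r ^+ 2 -> `|y| <= r ^+ 2 -> r ^+ 2 < `|x - y| -> x * y <= 0.
Proof.
move=> r0 x1 y1; rewrite ltNge [x * y <= 0]leNgt; apply: contra => xy.
move: x1 y1; rewrite !ler_norml => /andP[x0 x1] /andP[y0 y1].
case: (ltgtP x 0) => [x_lt|x_gt|x_0]; last by rewrite x_0 mul0r ltxx in xy.
- by rewrite nmulr_rgt0 // in xy; apply/andP; split; lra.
- by rewrite pmulr_rgt0 // in xy; apply/andP; split; lra.
Qed.

Lemma growth_bound (R : realFieldType) (I J : Type) (E : I -> J -> R) (l v : I -> R)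
    (u z : J -> R) (m g v0 z0 rho r : R) (r1 r2 r3 : I) (c1 c2 c3 : J) :
  two_steps E l v u z m g v0 z0 -> 2 < g -> 2 < rho -> 0 < r -> r <= 2 ->
  (forall i j, `|E i j| <= 1) -> E r1 c1 = 1 ->
  (forall i j, `|E i j - E i c1 * E r1 j| <= r) ->
  rho * r <= `|(E r2 c2 - E r2 c1 * E r1 c2) * (E r3 c3 - E r3 c1 * E r1 c3) -
               (E r2 c3 - E r2 c1 * E r1 c3) * (E r3 c2 - E r3 c1 * E r1 c2)| ->
  g * rho <= 484%:R / 100%:R.
Proof.
move=> ts g2 rho2 r0 r_le2 NE E11 HS det.
rewrite leNgt; apply/negP => K.
have det' := le_trans det (ler_normB _ _); rewrite !normrM in det'.
have Sr (i i' : I) (j j' : J) :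
    `|(E i j - E i c1 * E r1 j) * (E i' j' - E i' c1 * E r1 j')| <= r ^+ 2.
  by rewrite normrM expr2 ler_pM.
have r2rho : r ^+ 2 < rho * r by rewrite expr2 ltr_pM2r // (le_lt_trans r_le2).
have odd := odd_minor_of_large_det (ltW r0) (Sr _ _ _ _) (Sr _ _ _ _) (lt_le_trans r2rho det).
(* Exchanging rows or columns moves the bad entry to [(r3, c2)]; [det'] is symmetric under these
   exchanges. *)
case: (bad_entry_exists (E r2 c1) (E r3 c1) (E r1 c2) (E r1 c3) odd) => bad.
- apply: (@growth_of_bad_entry _ _ _ E l v u z m g v0 z0 rho r r1 r3 r2 c1 c2 c3) => //.
  by rewrite addrC; move: det'; clear; lra.
- apply: (@growth_of_bad_entry _ _ _ E l v u z m g v0 z0 rho r r1 r3 r2 c1 c3 c2) => //.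
  by move: det'; clear; lra.
- apply: (@growth_of_bad_entry _ _ _ E l v u z m g v0 z0 rho r r1 r2 r3 c1 c2 c3) => //.
- apply: (@growth_of_bad_entry _ _ _ E l v u z m g v0 z0 rho r r1 r2 r3 c1 c3 c2) => //.
  by move: det'; clear; lra.
Qed.

(** * From the factors L and U to normalized elimination steps *)

Lemma two_steps_of_elimination (R : realFieldType) (I J : Type) (F : I -> J -> R)
    (Lp Lq : I -> R) (Up Uq : J -> R) (a b c x y : R) :
  a != 0 -> b != 0 -> c != 0 ->
  (forall i, `|Lp i| <= 1) -> (forall i, `|Lq i| <= 1) ->
  (forall j, `|Up j| <= `|a|) -> (forall j, `|Uq j| <= `|b|) ->
  `|x| <= 1 -> `|y| <= `|a| -> `|b + x * y| <= `|a| ->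
  (forall i, `|Lq i * b + Lp i * y| <= `|a|) ->
  (forall j, `|Uq j + x * Up j| <= `|a|) ->
  (forall i j, `|F i j + Lq i * Uq j| <= `|b|) ->
  (forall i j, `|F i j + Lq i * Uq j + Lp i * Up j| <= `|a|) ->
  exists l v u z v0 z0,
    two_steps (fun i j => F i j / c) l v u z `|b / a| `|c / a| v0 z0.
Proof.
move=> a0 b0 c0 NLp NLq NUp NUq Nx Ny Hb Hcol Hrow HB HA.
pose s := Num.sg (b / a); pose t := Num.sg (c / a).
have ba0 : b / a != 0 by rewrite mulf_neq0 ?invr_eq0.
have ca0 : c / a != 0 by rewrite mulf_neq0 ?invr_eq0.
have sE : `|b / a| = s * (b / a) by rewrite normrEsg.
have tE : `|c / a| = t * (c / a) by rewrite normrEsg.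
have s2 : s * s = 1 by rewrite -expr2 sqr_sg ba0.
have ns : `|s| = 1 by rewrite normr_sg ba0.
have nt : `|t| = 1 by rewrite normr_sg ca0.
have div1 (w q : R) : q != 0 -> `|w| <= `|q| -> `|w / q| <= 1.
  by move=> q0 h; rewrite normrM normfV ler_pdivrMr ?normr_gt0 // mul1r.
(* The block rows are multiplied by [t] and the second pivot row by [s], which makes both pivot
   ratios positive. *)
exists (fun i => t * s * Lq i), (fun i => - (t * Lp i)), (fun j => - (Uq j / b)),
  (fun j => Up j / a), (- (s * x)), (y / a).
split=> [i|j|i|j||||i|j|i j|i j].
- by rewrite !normrM ns nt !mul1r.
- by rewrite normrN div1.
- by rewrite normrN normrM nt mul1r.
- exact: div1.
- by rewrite normrN normrM ns mul1r.
- exact: div1.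
- have -> : `|b / a| - - (s * x) * (y / a) = s * ((b + x * y) / a) by rewrite sE; ring.
  by rewrite normrM ns mul1r div1.
- have -> : `|b / a| * (t * s * Lq i) - - (t * Lp i) * (y / a) =
    t * ((Lq i * b * (s * s) + Lp i * y) / a) by rewrite sE; ring.
  by rewrite s2 mulr1 normrM nt mul1r div1.
- have -> : `|b / a| * - (Uq j / b) + - (s * x) * (Up j / a) = - s * ((Uq j + x * Up j) / a).
    by rewrite sE; field; rewrite a0 b0.
  by rewrite normrM normrN ns mul1r div1.
- have -> : `|c / a| * (F i j / c) - `|b / a| * (t * s * Lq i) * - (Uq j / b) =
    t * ((F i j + (s * s) * (Lq i * Uq j)) / a) by rewrite sE tE; field; rewrite a0 b0 c0.
  rewrite s2 mul1r normrM nt mul1r !normrM !normfV ler_pM2r ?invr_gt0 ?normr_gt0 //.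
- have -> : `|c / a| * (F i j / c) - `|b / a| * (t * s * Lq i) * - (Uq j / b)
      - - (t * Lp i) * (Up j / a) =
    t * ((F i j + (s * s) * (Lq i * Uq j) + Lp i * Up j) / a).
    by rewrite sE tE; field; rewrite a0 b0 c0.
  by rewrite s2 mul1r normrM nt mul1r div1.
Qed.

Section LU.
Variables (R : realType) (n : nat) (L U : 'M[R]_n.+1).
Hypothesis Llow : unit_lower_triangular L.
Hypothesis Uup : upper_triangular U.

(** The Schur complement after [k] steps, written without an inverse. *)
Definition lu_tail (k : nat) (i j : 'I_n.+1) : R :=
  \sum_(p < n.+1 | (k <= p)%N) L i p * U p j.

Lemma sum_lead (k : nat) (F : 'I_n.+1 -> R) : (k <= n.+1)%N ->
  \sum_(p < n.+1 | (p < k)%N) F p = \sum_(p < k) F (inord p).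
Proof.
move=> kn; rewrite (big_ord_narrow kn); apply: eq_bigr => p _.
by congr F; apply: val_inj; rewrite /= inordK // (leq_trans (ltn_ord p)).
Qed.

Lemma LU_lead (k : nat) : (k <= n.+1)%N ->
  lead_mx (L *m U) k = lead_mx L k *m lead_mx U k.
Proof.
move=> kn; apply/matrixP => p q; rewrite !mxE.
under [RHS]eq_bigr do rewrite !mxE.
rewrite -(sum_lead (fun t => L (inord p) t * U t (inord q))) //.
rewrite (bigID (fun t : 'I__ => (t < k)%N)) /= [X in _ + X]big1 ?addr0 // => t.
rewrite -leqNgt => kt; rewrite Uup ?mulr0 // inordK ?(leq_trans _ kn) //.
exact: leq_trans kt.
Qed.

(** The subtracted term is [x U_k (L_k U_k)^-1 L_k y] for leading blocks [L_k], [U_k]. It collapses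
    to [x y], the part of the product [L *m U] with inner index below [k]. *)
Lemma schur_LU (k : nat) (i j : 'I_n.+1) : (k <= n.+1)%N ->
  lead_mx (L *m U) k \in unitmx -> schur (L *m U) k i j = lu_tail k i j.
Proof.
move=> kn; rewrite LU_lead // => unitA.
have := unitA; rewrite unitmx_mul => /andP[unitL unitU].
pose x := \row_(p < k) L i (inord p); pose y := \col_(p < k) U (inord p) j.
have xE (q : 'I_k) : (L *m U) i (inord q) = (x *m lead_mx U k) 0 q.
  rewrite !mxE; under [RHS]eq_bigr do rewrite !mxE.
  rewrite -(sum_lead (fun t => L i t * U t (inord q))) //.
  rewrite (bigID (fun t : 'I__ => (t < k)%N)) /= [X in _ + X]big1 ?addr0 // => t.
  rewrite -leqNgt => kt; rewrite Uup ?mulr0 // inordK ?(leq_trans _ kn) //.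
  exact: leq_trans kt.
have yE (q : 'I_k) : (L *m U) (inord q) j = (lead_mx L k *m y) q 0.
  rewrite !mxE; under [RHS]eq_bigr do rewrite !mxE.
  rewrite -(sum_lead (fun t => L (inord q) t * U t j)) //.
  rewrite (bigID (fun t : 'I__ => (t < k)%N)) /= [X in _ + X]big1 ?addr0 // => t.
  rewrite -leqNgt => kt; rewrite (proj1 Llow) ?mul0r // inordK ?(leq_trans _ kn) //.
  exact: leq_trans kt.
rewrite /schur LU_lead //.
have -> : \sum_(p < k) \sum_(q < k) (L *m U) i (inord p) *
    invmx (lead_mx L k *m lead_mx U k) p q * (L *m U) (inord q) j =
    (x *m lead_mx U k *m invmx (lead_mx L k *m lead_mx U k) *m (lead_mx L k *m y)) 0 0.
  rewrite exchange_big [RHS]mxE; apply: eq_bigr => q _.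
  rewrite [X in _ = X * _]mxE mulr_suml; apply: eq_bigr => p _.
  by rewrite xE yE.
have cancelLU : lead_mx U k *m invmx (lead_mx L k *m lead_mx U k) *m lead_mx L k = 1%:M.
  have h : lead_mx L k *m (lead_mx U k *m invmx (lead_mx L k *m lead_mx U k) *m lead_mx L k) =
    lead_mx L k by rewrite !mulmxA mulmxV // mul1mx.
  by rewrite -[LHS](mulKmx unitL) h mulVmx.
have -> : x *m lead_mx U k *m invmx (lead_mx L k *m lead_mx U k) *m (lead_mx L k *m y) = x *m y.
  by rewrite -[in RHS](mul1mx y) -cancelLU !mulmxA.
rewrite mxE (bigID (fun t : 'I__ => (t < k)%N)) /= sum_lead //.
rewrite [X in _ - X]mxE; under [X in _ - X]eq_bigr do rewrite !mxE.
by rewrite addrAC subrr add0r; apply: eq_bigl => t; rewrite -leqNgt.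
Qed.

Lemma lu_tailS (k i j : 'I_n.+1) : lu_tail k i j = L i k * U k j + lu_tail k.+1 i j.
Proof.
rewrite /lu_tail (bigD1 k) //=; congr (_ + _); apply: eq_bigl => p.
by rewrite ltn_neqAle eq_sym andbC.
Qed.

Lemma lu_tail_eq0 (k : nat) (i j : 'I_n.+1) : (i < k)%N || (j < k)%N -> lu_tail k i j = 0.
Proof.
move=> ijk; rewrite /lu_tail big1 // => p kp.
case/orP: ijk => [ik|jk]; first by rewrite (proj1 Llow) ?mul0r // (leq_trans ik).
by rewrite Uup ?mulr0 // (leq_trans jk).
Qed.

Lemma lu_tail_row (k j : 'I_n.+1) : lu_tail k k j = U k j.
Proof. by rewrite lu_tailS (proj2 Llow) mul1r lu_tail_eq0 ?addr0 // ltnSn. Qed.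

Lemma lu_tail_col (k i : 'I_n.+1) : lu_tail k i k = L i k * U k k.
Proof. by rewrite lu_tailS lu_tail_eq0 ?addr0 // ltnSn orbT. Qed.

Lemma U_diag_neq0 (k : 'I_n.+1) : lead_mx (L *m U) k.+1 \in unitmx -> U k k != 0.
Proof.
rewrite LU_lead // unitmx_mul => /andP[_]; rewrite -unitmx_tr unitmxE det_trig.
  rewrite unitfE => /prodf_neq0 /(_ ord_max isT); rewrite !mxE /=.
  by rewrite (_ : inord k = k) //; apply: val_inj; rewrite /= inordK.
apply/is_trig_mxP => p q pq; rewrite !mxE Uup //.
have lt (t : 'I_k.+1) : (t < n.+1)%N by apply: leq_trans (ltn_ord t) (ltn_ord k).
by rewrite !inordK.
Qed.

Definition pivoted_at (k : 'I_n.+1) :=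
  forall i j : 'I_n.+1, (k <= i)%N -> (k <= j)%N -> `|lu_tail k i j| <= `|U k k|.

Lemma pivoted_L_le1 (k i : 'I_n.+1) :
  U k k != 0 -> pivoted_at k -> (k <= i)%N -> `|L i k| <= 1.
Proof.
move=> Uk /(_ i k) piv ki; have := piv ki (leqnn k).
by rewrite lu_tail_col normrM -[leRHS]mul1r ler_pM2r ?normr_gt0.
Qed.

Lemma pivoted_U_le (k j : 'I_n.+1) : pivoted_at k -> (k <= j)%N -> `|U k j| <= `|U k k|.
Proof. by move=> /(_ k j) piv kj; have := piv (leqnn k) kj; rewrite lu_tail_row. Qed.

Lemma next_pivot_le (k0 k1 : 'I_n.+1) : k1 = k0.+1 :> nat ->
  U k0 k0 != 0 -> pivoted_at k0 -> `|U k1 k1| <= 2 * `|U k0 k0|.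
Proof.
move=> k1E U0 piv; have k01 : (k0 <= k1)%N by rewrite k1E leqnSn.
have := piv _ _ k01 k01; rewrite lu_tailS -k1E lu_tail_row => h.
rewrite -[U k1 k1](addKr (L k1 k0 * U k0 k1)) (le_trans (ler_normD _ _)) // normrN normrM.
rewrite mulr_natl mulr2n lerD // -[leRHS]mul1r ler_pM //.
  exact: pivoted_L_le1.
exact: pivoted_U_le.
Qed.

(** The index type is cut down to indices from [k2] on, where the pivoting bounds hold. *)
Lemma two_steps_LU (k0 k1 k2 : 'I_n.+1) : k1 = k0.+1 :> nat -> k2 = k0.+2 :> nat ->
  U k0 k0 != 0 -> U k1 k1 != 0 -> U k2 k2 != 0 -> pivoted_at k0 -> pivoted_at k1 ->
  exists l v u z v0 z0,
    two_steps (fun i j : {i : 'I_n.+1 | (k2 <= i)%N} => lu_tail k2 (val i) (val j) / U k2 k2)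
      l v u z `|U k1 k1 / U k0 k0| `|U k2 k2 / U k0 k0| v0 z0.
Proof.
move=> k1E k2E U0 U1 U2 piv0 piv1.
have k01 : (k0 <= k1)%N by rewrite k1E leqnSn.
have k12 : (k1 <= k2)%N by rewrite k1E k2E leqnSn.
have T0 i j : lu_tail k0 i j = L i k0 * U k0 j + lu_tail k1 i j by rewrite lu_tailS k1E.
have T1 i j : lu_tail k1 i j = L i k1 * U k1 j + lu_tail k2 i j by rewrite lu_tailS k1E k2E.
pose I := {i : 'I_n.+1 | (k2 <= i)%N}.
have I1 (i : I) : (k1 <= val i)%N by apply: leq_trans (valP i).
have I0 (i : I) : (k0 <= val i)%N by apply: leq_trans (I1 i).
apply: (@two_steps_of_elimination _ I I (fun i j => lu_tail k2 (val i) (val j))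
  (fun i => L (val i) k0) (fun i => L (val i) k1) (fun j => U k0 (val j)) (fun j => U k1 (val j))
  (U k0 k0) (U k1 k1) (U k2 k2) (L k1 k0) (U k0 k1)) => // [i|i|j|j||||i|j|i j|i j].
- exact: pivoted_L_le1.
- exact: pivoted_L_le1.
- exact: pivoted_U_le.
- exact: pivoted_U_le.
- exact: pivoted_L_le1.
- exact: pivoted_U_le.
- by have := piv0 _ _ k01 k01; rewrite T0 lu_tail_row addrC.
- by have := piv0 _ _ (I0 i) k01; rewrite T0 lu_tail_col addrC.
- by have := piv0 _ _ k01 (I0 j); rewrite T0 lu_tail_row addrC.
- by have := piv1 _ _ (I1 i) (I1 j); rewrite T1 addrC.
- by have := piv0 _ _ (I0 i) (I0 j); rewrite T0 T1 addrC [L _ k1 * _ + _]addrC.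
Qed.

Lemma second_next_pivot_le (k0 k1 k2 : 'I_n.+1) : k1 = k0.+1 :> nat -> k2 = k0.+2 :> nat ->
  U k0 k0 != 0 -> U k1 k1 != 0 -> pivoted_at k0 -> pivoted_at k1 ->
  `|U k2 k2 / U k0 k0| <= 9 / 4.
Proof.
move=> k1E k2E U0 U1 piv0 piv1.
have [->|U2] := eqVneq (U k2 k2) 0; first by rewrite mul0r normr0; lra.
have [l [v [u [z [v0 [z0 ts]]]]]] := two_steps_LU k1E k2E U0 U1 U2 piv0 piv1.
rewrite leNgt; apply/negP => g94.
pose i : {i : 'I_n.+1 | (k2 <= i)%N} := exist _ k2 (leqnn k2).
have E1 : lu_tail k2 (val i) (val i) / U k2 k2 = 1 by rewrite lu_tail_row divff.
have g2 : 2 < `|U k2 k2 / U k0 k0| by lra.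
have [_ _ gm] := two_steps_pivot_bound ts g2 E1.
by have := le_lt_trans (le_trans gm (mul3Bm_le _)) g94; rewrite ltxx.
Qed.

End LU.

(** * The pivots of a 5 x 5 matrix and the growth factor *)

Lemma mx_maxnorm_le (R : realType) (p q : nat) (M : 'M[R]_(p, q)) (b : R) :
  0 <= b -> (forall i j, `|M i j| <= b) -> mx_maxnorm M <= b.
Proof.
move=> b0 h; rewrite /mx_maxnorm; apply: (big_ind (fun x => x <= b)) => // [x y|i _].
  by rewrite ge_max => -> ->.
by apply: (big_ind (fun x => x <= b)) => // x y; rewrite ge_max => -> ->.
Qed.

Lemma le_mx_maxnorm (R : realType) (p q : nat) (M : 'M[R]_(p, q)) (i : 'I_p) (j : 'I_q) :
  `|M i j| <= mx_maxnorm M.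
Proof.
by rewrite /mx_maxnorm (bigD1 i) //= le_max (bigD1 j) //= le_max lexx.
Qed.

Lemma last_pivot_le (R : realType) (L U : 'M[R]_5) (k : nat -> 'I_5) :
  (forall p, (p < 5)%N -> k p = p :> nat) ->
  unit_lower_triangular L -> upper_triangular U ->
  (forall p, (p < 4)%N -> U (k p) (k p) != 0) ->
  (forall p, (p < 4)%N -> pivoted_at L U (k p)) ->
  `|U (k 4) (k 4) / U (k 0) (k 0)| <= 484%:R / 100%:R.
Proof.
move=> kE Llow Uup Un piv.
have [->|U4] := eqVneq (U (k 4) (k 4)) 0; first by rewrite mul0r normr0 divr_ge0 ?ler0n.
have succ p : (p < 4)%N -> k p.+1 = (k p).+1 :> nat by move=> p4; rewrite !kE // ltnW.
have succ2 p : (p < 3)%N -> k p.+2 = (k p).+2 :> nat by move=> p3; rewrite !kE // ltnW // ltnW.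
have g94 := second_next_pivot_le Llow Uup (succ 0 isT) (succ2 0 isT) (Un 0 isT) (Un 1 isT)
  (piv 0 isT) (piv 1 isT).
have rho94 := second_next_pivot_le Llow Uup (succ 2 isT) (succ2 2 isT) (Un 2 isT) (Un 3 isT)
  (piv 2 isT) (piv 3 isT).
have U2 := Un 2 isT; have U0 := Un 0 isT; have U3 := Un 3 isT.
have -> : U (k 4) (k 4) / U (k 0) (k 0) =
    (U (k 2) (k 2) / U (k 0) (k 0)) * (U (k 4) (k 4) / U (k 2) (k 2)).
  by field; rewrite U0 U2.
rewrite normrM; set g := `|_| in g94 *; set rho := `|_| in rho94 *.
(* Both ratios are at most 9 / 4, so if one is at most 2 the product is at most 9 / 2. *)
case: (lerP g 2) => g2.
  have : g * rho <= 2 * (9 / 4) by rewrite ler_pM ?normr_ge0.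
  by move=> h; apply: le_trans h _; lra.
case: (lerP rho 2) => rho2.
  have : g * rho <= (9 / 4) * 2 by rewrite ler_pM ?normr_ge0.
  by move=> h; apply: le_trans h _; lra.
have [l [v [u [z [v0 [z0 ts]]]]]] := two_steps_LU Llow Uup (succ 0 isT) (succ2 0 isT)
  U0 (Un 1 isT) U2 (piv 0 isT) (piv 1 isT).
pose I := {i : 'I_5 | (k 2 <= i)%N}.
have k2p p : (2 <= p < 5)%N -> (k 2 <= k p)%N by move=> /andP[p2 p5]; rewrite !kE.
pose idx p (h : (2 <= p < 5)%N) : I := exist _ (k p) (k2p p h).
pose T := lu_tail L U.
have T2 i j : T (k 2) i j = L i (k 2) * U (k 2) j + T (k 3) i j.
  by rewrite /T lu_tailS -(succ 2 isT).
have T3 i j : T (k 3) i j = L i (k 3) * U (k 3) j + T (k 4) i j.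
  by rewrite /T lu_tailS -(succ 3 isT).
have SE (i j : 'I_5) : T (k 2) i j / U (k 2) (k 2) -
    T (k 2) i (k 2) / U (k 2) (k 2) * (T (k 2) (k 2) j / U (k 2) (k 2)) =
    T (k 3) i j / U (k 2) (k 2).
  by rewrite [T (k 2) i (k 2)]lu_tail_col // [T (k 2) (k 2) j]lu_tail_row // T2; field.
apply: (@growth_bound _ I I _ l v u z _ _ v0 z0 rho `|U (k 3) (k 3) / U (k 2) (k 2)|
  (idx 2 isT) (idx 3 isT) (idx 4 isT) (idx 2 isT) (idx 3 isT) (idx 4 isT) ts) => //=.
- by rewrite normr_gt0 mulf_neq0 ?invr_eq0.
- rewrite normrM normfV ler_pdivrMr ?normr_gt0 //.
  exact: (next_pivot_le Llow Uup (succ 2 isT)) (piv 2 isT).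
- move=> i j; rewrite normrM normfV ler_pdivrMr ?normr_gt0 // mul1r.
  exact: (piv 2 isT) _ _ (valP i) (valP j).
- by rewrite lu_tail_row // divff.
- move=> i j; rewrite SE !normrM ler_pM2r ?normfV ?invr_gt0 ?normr_gt0 //.
  (* Row and column [k 2] are in the index type but already eliminated, so the Schur complement
     vanishes there. *)
  case: (ltnP (val i) (k 3)) => ik.
    by rewrite /T lu_tail_eq0 ?ik // normr0.
  case: (ltnP (val j) (k 3)) => jk.
    by rewrite /T lu_tail_eq0 ?jk ?orbT // normr0.
  exact: (piv 3 isT).
(* The determinant of the last 2 x 2 Schur complement is the product of the last two pivots, so
   equality holds. *)
- rewrite !SE.
  have T33 : T (k 3) (k 3) (k 3) = U (k 3) (k 3) by rewrite /T lu_tail_row.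
  have T34 : T (k 3) (k 3) (k 4) = U (k 3) (k 4) by rewrite /T lu_tail_row.
  have T43 : T (k 3) (k 4) (k 3) = L (k 4) (k 3) * U (k 3) (k 3) by rewrite /T lu_tail_col.
  have T44 : T (k 3) (k 4) (k 4) = L (k 4) (k 3) * U (k 3) (k 4) + U (k 4) (k 4).
    by rewrite T3 [T (k 4) _ _]lu_tail_row.
  rewrite T33 T34 T43 T44 /rho -normrM le_eqVlt; apply/orP; left; apply/eqP; congr `|_|.
  by field.
Qed.

Theorem theorem2 (R : realType) (A L U : 'M[R]_5) :
  (forall k : nat, (k < 5)%N -> lead_mx A k \in unitmx) ->
  completely_pivoted A ->
  unit_lower_triangular L -> upper_triangular U -> A = L *m U ->
  growth_factor A L U <= 484%:R / 100%:R.
Proof.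
move=> unitA pivA Llow Uup AE; rewrite {}AE in unitA pivA *.
have Un (k : 'I_5) : (k < 4)%N -> U k k != 0 by move=> k4; apply: U_diag_neq0 (unitA _ _).
have piv (k : 'I_5) : (k < 4)%N -> pivoted_at L U k.
  move=> k4 i j ki kj; have := pivA _ k4 i j ki kj.
  by rewrite inord_val !schur_LU ?lu_tail_row ?unitA // ltnW.
have b0 : 0 <= 484%:R / 100%:R :> R by rewrite divr_ge0 ?ler0n.
have N00 : `|U ord0 ord0| <= mx_maxnorm (L *m U).
  apply: le_trans (le_mx_maxnorm _ ord0 ord0).
  by rewrite -(lu_tail_row Llow Uup) /lu_tail mxE.
have N0 : 0 < mx_maxnorm (L *m U) by apply: lt_le_trans N00; rewrite normr_gt0 Un.
rewrite /growth_factor ge_max; apply/andP; split.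
  apply: mx_maxnorm_le => // i j; have [ij|ji] := ltnP i j.
    by rewrite (proj1 Llow) ?normr0.
  have [j4|j4] := ltnP j 4.
    apply: (@le_trans _ _ 1); last by lra.
    exact: (@pivoted_L_le1 _ _ L U Llow Uup j i (Un _ j4) (piv _ j4) ji).
  have -> : i = j.
    by apply/val_inj/eqP; rewrite eqn_leq /= ji andbT (leq_trans _ j4) // -ltnS ltn_ord.
  rewrite (proj2 Llow) normr1; lra.
rewrite ler_pdivrMr //; apply: mx_maxnorm_le => [|i j].
  by rewrite mulr_ge0 // ltW.
apply: (@le_trans _ _ (484%:R / 100%:R * `|U ord0 ord0|)); last by rewrite ler_wpM2l.
have [ji|ij] := ltnP j i; first by rewrite Uup // normr0 mulr_ge0.
apply: (@le_trans _ _ `|U i i|).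
  have [i4|i4] := ltnP i 4; first by apply: pivoted_U_le (piv _ i4) _.
  suff -> : i = j by [].
  by apply/val_inj/eqP; rewrite eqn_leq /= ij (leq_trans _ i4) // -ltnS ltn_ord.
pose k (p : nat) : 'I_5 := inord p.
have kE p : (p < 5)%N -> k p = p :> nat by move=> p5; rewrite inordK.
have k0E : k 0 = ord0 by apply: val_inj; rewrite /= kE.
have Uk p : (p < 4)%N -> U (k p) (k p) != 0 by move=> p4; rewrite Un // kE // ltnW.
have pk p : (p < 4)%N -> pivoted_at L U (k p) by move=> p4; apply: piv; rewrite kE // ltnW.
have U0 : 0 < `|U (k 0) (k 0)| by rewrite normr_gt0 Uk.
have next p : (p < 4)%N -> `|U (k p.+1) (k p.+1)| <= 2 * `|U (k p) (k p)|.
  by move=> p4; apply: next_pivot_le (Uk _ p4) (pk _ p4) => //; rewrite !kE // ltnW.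
have U2 : `|U (k 2) (k 2)| <= 9 / 4 * `|U (k 0) (k 0)|.
  rewrite -ler_pdivrMr // -normfV -normrM.
  by apply: second_next_pivot_le (Uk 0 isT) (Uk 1 isT) (pk 0 isT) (pk 1 isT); rewrite ?kE.
have U4 : `|U (k 4) (k 4)| <= 484%:R / 100%:R * `|U (k 0) (k 0)|.
  by rewrite -ler_pdivrMr // -normfV -normrM; exact: (@last_pivot_le _ L U k kE).
have [U1 U3] := (next 0 isT, next 2 isT).
rewrite -k0E (_ : i = k i); last by rewrite /k inord_val.
(* Relative to the first pivot, the five pivots are bounded by 1, 2, 9 / 4, 9 / 2 and 484 / 100. *)
case: (val i) (ltn_ord i) => [|[|[|[|[|]]]]] // _; lra.
Qed.
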